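(* Let $p\in[1,\infty]$ and let $(\rho_{st})_{0\le s\le t\le T}$, $\rho_{st}:L_p(\mathcal F_t)\to L_p(\mathcal F_s)$, be a fully-dynamic convex risk measure. The following assertions are equivalent: (i) $(\rho_{st})_{s,t}$ is strong time-consistent. (ii) $(\rho_{st})_{s,t}$ is time-consistent and $$\rho_{rt}(Y)=\rho_{rs}\big(Y-\rho_{st}(0)\big)\qquad\text{for all } 0\le r\le s\le t\le T \text{ and all } Y\in L_p(\mathcal F_s).$$
   Context: Let $T\in(0,\infty)$ and let $(\Omega,\mathcal F,(\mathcal F_t)_{t\in[0,T]},P)$ be a complete filtered probability space with $\mathcal F_0$ trivial; $L_p(\mathcal F_t)=L_p(\Omega,\mathcal F_t,P)$. Relations between random variables hold $P$-a.s. A fully-dynamic convex risk measure on $(L_p(\mathcal F_t))_t$ is a family of mappings $\rho_{st}:L_p(\mathcal F_t)\to L_p(\mathcal F_s)$, $0\le s\le t\le T$, each of which is: monotone ($\rho_{st}(X')\le\rho_{st}(X'')$ if $X'\ge X''$); convex ($\rho_{st}(\lambda X'+(1-\lambda)X'')\le\lambda\rho_{st}(X')+(1-\lambda)\rho_{st}(X'')$, $\lambda\in[0,1]$); $\mathcal F_s$-translation invariant ($\rho_{st}(X+f)=\rho_{st}(X)-f$ for $f\in L_p(\mathcal F_s)$); and, if $p=\infty$, continuous from below ($X_n\uparrow X$ $P$-a.s. in $L_\infty(\mathcal F_t)$ implies $\rho_{st}(X_n)\downarrow\rho_{st}(X)$ $P$-a.s.). Normalisation $\rho_{st}(0)=0$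 is not assumed. Strong time-consistent: for all $r\le s\le t$, $\rho_{rt}(X)=\rho_{rs}(-\rho_{st}(X))$ for all $X\in L_p(\mathcal F_t)$. Time-consistent: for all $r\le s\le t$ and all $X,Y\in L_p(\mathcal F_t)$, $\rho_{st}(X)=\rho_{st}(Y)$ implies $\rho_{rt}(X)=\rho_{rt}(Y)$. *)

(* Defs.v *)
From HB Require Import structures.
From mathcomp Require Import all_boot all_order all_algebra.
From mathcomp Require Import all_classical all_reals all_analysis.

Set Implicit Arguments.
Unset Strict Implicit.
Unset Printing Implicit Defensive.

Import Order.TTheory GRing.Theory Num.Theory.
Import numFieldNormedType.Exports.

Local Open Scope classical_set_scope.
Local Open Scope ring_scope.

(* Only the sigma-algebras [F t] with [0 <= t <= T] are constrained.
   [P.-negligible] consists of all subsets of measurable sets of probability 0. *)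
Record complete_filtration d (Omega : measurableType d) (R : realType)
    (P : probability Omega R) (T : R) (F : R -> set_system Omega) : Prop := {
  filtration_sigma_algebra : forall t, 0 <= t -> t <= T ->
    sigma_algebra [set: Omega] (F t) ;
  filtration_measurable : forall t, 0 <= t -> t <= T -> F t `<=` measurable ;
  filtration_le : forall s t, 0 <= s -> s <= t -> t <= T -> F s `<=` F t ;
  filtration_complete : measure_is_complete P ;
  filtration_negligible : P.-negligible `<=` F 0 }.

Definition trivial_sigma_algebra d (Omega : measurableType d) (R : realType)
    (P : probability Omega R) (G : set_system Omega) : Prop :=
  forall A, G A -> P A = 0%E \/ P A = 1%E.

(* [g_sigma_algebraType G] is Omega equipped with the sigma-algebra generated
   by [G], which is [G] itself when [G] is a sigma-algebra. Elements of
   L_p(G) are given by representatives; equality in L_p(G) is [%[ae P]]. *)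
Definition Lp d (Omega : measurableType d) (R : realType)
    (P : probability Omega R) (p : \bar R) (G : set_system Omega) :
    set (Omega -> R) :=
  [set X | X \in Lfun P p /\
     measurable_fun [set: g_sigma_algebraType G]
       (X : g_sigma_algebraType G -> R)].

(* [rho] acts on representatives; its values outside L_p(Gt) are irrelevant,
   and monotonicity makes it compatible with a.s. equality on L_p(Gt), see
   [convex_risk_measure_ae_eq]. *)
Record convex_risk_measure d (Omega : measurableType d) (R : realType)
    (P : probability Omega R) (p : \bar R) (Gs Gt : set_system Omega)
    (rho : (Omega -> R) -> (Omega -> R)) : Prop := {
  risk_Lp : forall X, Lp P p Gt X -> Lp P p Gs (rho X) ;
  risk_monotone : forall X1 X2, Lp P p Gt X1 -> Lp P p Gt X2 ->
    (\forall w \ae P, X2 w <= X1 w) ->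
    \forall w \ae P, rho X1 w <= rho X2 w ;
  risk_convex : forall X1 X2, Lp P p Gt X1 -> Lp P p Gt X2 ->
    forall l : R, 0 <= l -> l <= 1 ->
    \forall w \ae P, rho (l \*o X1 + (1 - l) \*o X2) w
                     <= l * rho X1 w + (1 - l) * rho X2 w ;
  risk_translation : forall X f, Lp P p Gt X -> Lp P p Gs f ->
    rho (X + f) = rho X - f %[ae P] ;
  risk_continuous_below : p = +oo%E ->
    forall (X_ : nat -> Omega -> R) X,
    (forall n, Lp P p Gt (X_ n)) -> Lp P p Gt X ->
    (\forall w \ae P, nondecreasing_seq (fun n => X_ n w) /\
                      (fun n => X_ n w) @ \oo --> X w) ->
    \forall w \ae P, nonincreasing_seq (fun n => rho (X_ n) w) /\
                     (fun n => rho (X_ n) w) @ \oo --> rho X w }.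

Lemma convex_risk_measure_ae_eq d (Omega : measurableType d) (R : realType)
    (P : probability Omega R) (p : \bar R) (Gs Gt : set_system Omega)
    (rho : (Omega -> R) -> (Omega -> R)) :
  convex_risk_measure P p Gs Gt rho ->
  forall X Y, Lp P p Gt X -> Lp P p Gt Y ->
  X = Y %[ae P] -> rho X = rho Y %[ae P].
Proof.
move=> crm X Y LX LY XY.
have YX : \forall w \ae P, rho X w <= rho Y w.
  by apply: (risk_monotone crm) => //; apply: filterS XY => w ->.
have {}XY : \forall w \ae P, rho Y w <= rho X w.
  by apply: (risk_monotone crm) => //; apply: filterS XY => w ->.
by apply: filterS2 YX XY => w le1 le2 _; apply/le_anti/andP.
Qed.

Definition fully_dynamic_convex_risk_measure d (Omega : measurableType d)
    (R : realType) (P : probability Omega R) (T : R) (F : R -> set_system Omega)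
    (p : \bar R) (rho : R -> R -> (Omega -> R) -> (Omega -> R)) : Prop :=
  forall s t, 0 <= s -> s <= t -> t <= T ->
  convex_risk_measure P p (F s) (F t) (rho s t).

Definition strong_time_consistent d (Omega : measurableType d)
    (R : realType) (P : probability Omega R) (T : R) (F : R -> set_system Omega)
    (p : \bar R) (rho : R -> R -> (Omega -> R) -> (Omega -> R)) : Prop :=
  forall r s t, 0 <= r -> r <= s -> s <= t -> t <= T ->
  forall X, Lp P p (F t) X ->
  rho r t X = rho r s (- rho s t X) %[ae P].

Definition time_consistent d (Omega : measurableType d)
    (R : realType) (P : probability Omega R) (T : R) (F : R -> set_system Omega)
    (p : \bar R) (rho : R -> R -> (Omega -> R) -> (Omega -> R)) : Prop :=
  forall r s t, 0 <= r -> r <= s -> s <= t -> t <= T ->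
  forall X Y, Lp P p (F t) X -> Lp P p (F t) Y ->
  rho s t X = rho s t Y %[ae P] -> rho r t X = rho r t Y %[ae P].

(* Main.v *)
Require Import Defs.
From mathcomp Require Import all_boot all_order all_algebra.
From mathcomp Require Import all_classical all_reals all_analysis.
From mathcomp Require Import measurable_realfun.

Import Order.TTheory GRing.Theory.

Local Open Scope classical_set_scope.
Local Open Scope ring_scope.

(** By translation invariance [rho_st Y = rho_st 0 - Y] for [Y] in [L_p(F_s)],
    so restricting [rho_rt = rho_rs o (- rho_st)] to [L_p(F_s)] is the identity
    of (ii). Conversely, given [X] in [L_p(F_t)], the [F_s]-measurable variable
    [Y = rho_st 0 - rho_st X] satisfies [rho_st Y = rho_st X], so
    time-consistency reduces strong time-consistency at [X] to (ii) at [Y]. *)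

Lemma Lp0 {d : measure_display} {Omega : measurableType d} {R : realType}
    (P : probability Omega R) {p : \bar R} (G : set_system Omega) :
  (1%:E <= p)%E -> Lp P p G 0.
Proof.
move=> p1; split; last exact: measurable_cst.
by have [+ _] := GRing.submod_closedB (Lfun_submod_closed P p1).
Qed.

Lemma LpB {d : measure_display} {Omega : measurableType d} {R : realType}
    {P : probability Omega R} {p : \bar R} {G : set_system Omega}
    {X Y : Omega -> R} :
  (1%:E <= p)%E -> Lp P p G X -> Lp P p G Y -> Lp P p G (X - Y).
Proof.
move=> p1 [LX mX] [LY mY]; split; last exact: measurable_funB.
by have [_ +] := GRing.submod_closedB (Lfun_submod_closed P p1); apply.
Qed.

Lemma LpN {d : measure_display} {Omega : measurableType d} {R : realType}
    {P : probability Omega R} {p : \bar R} {G : set_system Omega}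
    {X : Omega -> R} :
  (1%:E <= p)%E -> Lp P p G X -> Lp P p G (- X).
Proof. by move=> p1 LX; rewrite -[- X]add0r; apply: LpB => //; exact: Lp0. Qed.

(** Measurability in [Lp] refers to the generated sigma-algebra, and generation is monotone in the
    generators. *)
Lemma Lp_subset {d : measure_display} {Omega : measurableType d}
    {R : realType} {P : probability Omega R} {p : \bar R}
    {G H : set_system Omega} :
  G `<=` H -> Lp P p G `<=` Lp P p H.
Proof.
move=> GH X [LX mX]; split=> // _ B mB.
exact: (sub_sigma_algebra2 GH (mX measurableT B mB)).
Qed.

(** Translation invariance at the zero position; [rho 0] stays since normalisation is not
    assumed. *)
Lemma convex_risk_measure_restrict {d : measure_display}
    {Omega : measurableType d} {R : realType} {P : probability Omega R}
    {p : \bar R} {Gs Gt : set_system Omega}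
    {rho : (Omega -> R) -> (Omega -> R)} {Y : Omega -> R} :
  (1%:E <= p)%E -> convex_risk_measure P p Gs Gt rho -> Lp P p Gs Y ->
  rho Y = rho 0 - Y %[ae P].
Proof.
move=> p1 crm LY; have := risk_translation crm (Lp0 P Gt p1) LY.
by rewrite add0r.
Qed.

Theorem proposition2p15 (R : realType) (d : measure_display)
    (Omega : measurableType d) (P : probability Omega R)
    (T : R) (F : R -> set_system Omega) (p : \bar R)
    (rho : R -> R -> (Omega -> R) -> (Omega -> R)) :
  0 < T ->
  complete_filtration P T F ->
  trivial_sigma_algebra P (F 0) ->
  (1%:E <= p)%E ->
  fully_dynamic_convex_risk_measure P T F p rho ->
  strong_time_consistent P T F p rho <->
  (time_consistent P T F p rho /\
   forall r s t, 0 <= r -> r <= s -> s <= t -> t <= T ->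
   forall Y, Lp P p (F s) Y ->
   rho r t Y = rho r s (Y - rho s t 0) %[ae P]).
Proof.
move=> _ filtF _ p1 crm.
split=> [stc|[tc rhoE]] => [|r s t r0 rs st tT X LX].
- split=> r s t r0 rs st tT => [X Y LX LY XY|Y LY];
    have s0 := le_trans r0 rs; have sT := le_trans st tT;
    have crm_st := crm s t s0 st tT; have crm_rs := crm r s r0 rs sT.
  (* Strong consistency factors [rho r t X] and [rho r t Y] through [rho r s], at arguments that
     agree almost surely; monotonicity makes [rho r s] respect such equality. *)
  + apply: ae_eq_trans (stc _ _ _ r0 rs st tT X LX) _.
    apply: ae_eq_sym; apply: ae_eq_trans (stc _ _ _ r0 rs st tT Y LY) _.
    apply: (convex_risk_measure_ae_eq crm_rs);
      [by apply: LpN => //; exact: (risk_Lp crm_st)..|].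
    by apply: filterS XY => w /= + wT; move=> /(_ wT); rewrite /= !fctE => ->.
  + have LtY : Lp P p (F t) Y.
      by apply: Lp_subset LY; exact: (filtration_le filtF).
    apply: ae_eq_trans (stc _ _ _ r0 rs st tT Y LtY) _.
    apply: (convex_risk_measure_ae_eq crm_rs).
    * by apply: LpN => //; exact: (risk_Lp crm_st).
    * by apply: LpB => //; apply: (risk_Lp crm_st); exact: Lp0.
    (* Almost surely, [- rho s t Y = - (rho s t 0 - Y) = Y - rho s t 0]. *)
    * apply: filterS (convex_risk_measure_restrict p1 crm_st LY) => w /= + wT.
      by move=> /(_ wT); rewrite /= !fctE => ->; rewrite opprB.
- have s0 := le_trans r0 rs; have crm_st := crm s t s0 st tT.
  (* [Y] solves [rho s t 0 - Y = rho s t X], whose left side is almost surely [rho s t Y] once [Y]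
     lies in [Lp P p (F s)]. *)
  pose Y := rho s t 0 - rho s t X.
  have LY : Lp P p (F s) Y.
    by apply: LpB => //; apply: (risk_Lp crm_st) => //; exact: Lp0.
  have LtY : Lp P p (F t) Y.
    by apply: Lp_subset LY; exact: (filtration_le filtF).
  have XY : rho s t X = rho s t Y %[ae P].
    apply: ae_eq_sym.
    have := convex_risk_measure_restrict p1 crm_st LY.
    by rewrite /Y subKr.
  apply: ae_eq_trans (tc _ _ _ r0 rs st tT X Y LX LtY XY) _.
  (* Subtracting [rho s t 0] cancels the same term in [Y] and leaves [- rho s t X]. *)
  have := rhoE _ _ _ r0 rs st tT Y LY.
  by rewrite /Y addrAC subrr add0r.
Qed.
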